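(* Let $\Omega$ be a countably infinite set, $S=\mathrm{Sym}(\Omega)$, and let $G$ be a closed subgroup of $S$. Then $G\approx S$ (i.e., there is a finite set $U\subseteq S$ with $\langle G\cup U\rangle=S$) if and only if for every finite subset $\Gamma\subseteq\Omega$, the subgroup $G_{(\Gamma)}$ has at least one infinite orbit in $\Omega$.
   Context: $\mathrm{Sym}(\Omega)$ is the group of all permutations of $\Omega$, written to the right of their arguments. $S$ carries the function topology (pointwise convergence, $\Omega$ discrete), a subbasis of open sets being $\{f\in S:\alpha f=\beta\}$ for $\alpha,\beta\in\Omega$; ''closed'' means closed in $S$ in this topology. For $G\le S$ and $\Gamma\subseteq\Omega$, $G_{(\Gamma)}=\{g\in G:\gamma g=\gamma\ \forall\gamma\in\Gamma\}$. For subgroups $G_1,G_2\le S$, $G_1\preccurlyeq G_2$ means there is a finite $U\subseteq S$ with $G_1\le\langle G_2\cup U\rangle$, and $G_1\approx G_2$ means $G_1\preccurlyeq G_2$ and $G_2\preccurlyeq G_1$. *)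

(* Defs.v *)
(* Subsets of Sym(Omega) are predicates on functions T -> T. *)
From Stdlib Require Import List.

Set Implicit Arguments.

Section Defs.
Variable T : Type.

Definition countably_infinite : Prop :=
  exists e : nat -> T, (forall m n, e m = e n -> m = n) /\ (forall t, exists n, e n = t).

Definition finite_set {A : Type} (P : A -> Prop) : Prop :=
  exists l : list A, forall a, P a -> In a l.

Definition Sym (f : T -> T) : Prop :=
  exists g : T -> T, (forall x, g (f x) = x) /\ (forall x, f (g x) = x).

Definition is_subgroup (H : (T -> T) -> Prop) : Prop :=
  (forall h, H h -> Sym h) /\
  (forall a b, (forall x, a x = b x) -> H a -> H b) /\
  H (fun x => x) /\
  (forall a b, H a -> H b -> H (fun x => b (a x))) /\
  (forall a, H a -> exists c, H c /\ (forall x, c (a x) = x) /\ (forall x, a (c x) = x)).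

Definition generated (A : (T -> T) -> Prop) : (T -> T) -> Prop :=
  fun f => forall H, is_subgroup H -> (forall a, A a -> H a) -> H f.

(* Closed in the topology of pointwise convergence on Sym(Omega):
   every f in Sym(Omega) each of whose basic neighbourhoods meets G lies in G. *)
Definition closed_sub (G : (T -> T) -> Prop) : Prop :=
  forall f, Sym f ->
    (forall Gamma : list T, exists g, G g /\ (forall x, In x Gamma -> g x = f x)) ->
    G f.

Definition preceq (G1 G2 : (T -> T) -> Prop) : Prop :=
  exists U : (T -> T) -> Prop, finite_set U /\ (forall u, U u -> Sym u) /\
    (forall f, G1 f -> generated (fun h => G2 h \/ U h) f).

Definition approx (G1 G2 : (T -> T) -> Prop) : Prop := preceq G1 G2 /\ preceq G2 G1.

Definition ptstab (G : (T -> T) -> Prop) (Gamma : T -> Prop) : (T -> T) -> Prop :=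
  fun g => G g /\ (forall y, Gamma y -> g y = y).

Definition orbit (H : (T -> T) -> Prop) (alpha : T) : T -> Prop :=
  fun beta => exists h, H h /\ h alpha = beta.

End Defs.

(* Main.v *)
(** If every orbit of the stabiliser of a finite set is finite, then over [G] the
    finite set [U] yields [Sym T] as a countable union of sets of words, each of
    which moves any given point to finitely many places; a diagonal involution
    escapes all of them.

    Conversely, choose points [alp 0, alp 1, ...], each with an infinite orbit
    under the stabiliser of a finite set that grows along the construction, and a
    tree of elements of [G] whose nodes are sequences of involutions of consecutive
    blocks of indices. Infinite orbits let the node elements send their blocks to
    pairwise distinct places of [T], so a single involution [u] can act at every
    such place as the involution recorded in the node. By closedness each branch
    converges to some [k] in [G], and [k^-1 u k] permutes the points [alp j] by the
    involution that the branch describes. Products of these induce every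
    permutation of [{alp (2 j)}]; a commutator with a shift then gives all
    permutations supported on a moiety, and two further permutations give [Sym T]. *)

Require Import Defs.
From Stdlib Require Import List Arith Lia Bool Classical ClassicalEpsilon Cantor.
From Stdlib Require FinFun.
Import ListNotations.

(** * Finite and infinite sets *)

Definition injective {A B : Type} (f : A -> B) : Prop :=
  forall x y, f x = f y -> x = y.

Definition inverses {A B : Type} (f : A -> B) (g : B -> A) : Prop :=
  (forall x, g (f x) = x) /\ (forall y, f (g y) = y).

Lemma choice_fun {A B : Type} (R : A -> B -> Prop) :
  (forall a, exists b, R a b) -> exists f : A -> B, forall a, R a (f a).
Proof.
  intros H.
  exists (fun a => proj1_sig (constructive_indefinite_description _ (H a))).
  intros a. exact (proj2_sig (constructive_indefinite_description _ (H a))).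
Qed.

Lemma inverses_injective {A B : Type} (f : A -> B) g : inverses f g -> injective f.
Proof. intros [H _] x y E. rewrite <- (H x), <- (H y), E. reflexivity. Qed.

Lemma inverses_sym {A B : Type} (f : A -> B) g : inverses f g -> inverses g f.
Proof. intros [H1 H2]. split; assumption. Qed.

Lemma Sym_injective {T : Type} (f : T -> T) : Sym f -> injective f.
Proof. intros [g Hg]. exact (inverses_injective f g Hg). Qed.

Lemma bijection_Sym {T : Type} (f : T -> T) :
  injective f -> (forall y, exists x, f x = y) -> Sym f.
Proof.
  intros inj surj. destruct (choice_fun _ surj) as [g Hg].
  exists g. split; auto.
Qed.

Lemma involution_Sym {T : Type} (f : T -> T) : (forall x, f (f x) = x) -> Sym f.
Proof. intros H. exists f. split; exact H. Qed.

Lemma finite_sub {A : Type} (P Q : A -> Prop) :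
  finite_set Q -> (forall x, P x -> Q x) -> finite_set P.
Proof. intros [l Hl] H. exists l. auto. Qed.

Lemma finite_or {A : Type} (P Q : A -> Prop) :
  finite_set P -> finite_set Q -> finite_set (fun x => P x \/ Q x).
Proof.
  intros [l Hl] [m Hm]. exists (l ++ m). intros x [H | H]; apply in_or_app; auto.
Qed.

Lemma finite_In {A : Type} (l : list A) : finite_set (fun x => In x l).
Proof. exists l. auto. Qed.

Lemma finite_lt (n : nat) : finite_set (fun m => m < n).
Proof. exists (seq 0 n). intros m H. apply in_seq. lia. Qed.

Lemma finite_bind {A B : Type} (P : A -> Prop) (Q : A -> B -> Prop) :
  finite_set P -> (forall a, P a -> finite_set (Q a)) ->
  finite_set (fun b => exists a, P a /\ Q a b).
Proof.
  intros [l Hl] HQ.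
  assert (H : finite_set (fun b => exists a, In a l /\ P a /\ Q a b)).
  { clear Hl. induction l as [|a l IH].
    - exists []. intros b (a & [] & _).
    - destruct (classic (P a)) as [Pa | nPa].
      + refine (finite_sub _ _ (finite_or _ _ (HQ a Pa) IH) _).
        intros b (a' & [<- | H] & Pa' & Hb); [now left | right; eauto].
      + refine (finite_sub _ _ IH _).
        intros b (a' & [<- | H] & Pa' & Hb); [contradiction | eauto]. }
  refine (finite_sub _ _ H _). intros b (a & Pa & Hb). eauto.
Qed.

Lemma finite_image {A B : Type} (f : A -> B) (P : A -> Prop) :
  finite_set P -> finite_set (fun y => exists x, P x /\ y = f x).
Proof.
  intros HP. apply finite_bind; [exact HP |].
  intros a _. exists [f a]. intros b ->. now left.
Qed.

Lemma finite_preimage {A B : Type} (f : A -> B) (P : B -> Prop) :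
  injective f -> finite_set P -> finite_set (fun x => P (f x)).
Proof.
  intros inj HP.
  apply finite_sub with (fun x => exists y, P y /\ f x = y); [| eauto].
  apply finite_bind; [exact HP |]. intros y _.
  destruct (classic (exists x, f x = y)) as [[x Hx] | N].
  - exists [x]. intros x' E. left. apply inj. congruence.
  - exists []. intros x E. apply N. eauto.
Qed.

Lemma infinite_fresh {A : Type} (P : A -> Prop) :
  ~ finite_set P -> forall l, exists x, P x /\ ~ In x l.
Proof.
  intros H l. apply NNPP. intros N. apply H. exists l.
  intros a Pa. apply NNPP. intros Na. apply N. eauto.
Qed.

Lemma infinite_of_sequence {A : Type} (P : A -> Prop) (x : nat -> A) :
  injective x -> (forall n, P (x n)) -> ~ finite_set P.
Proof.
  intros inj HP [l Hl].
  assert (nd : NoDup (map x (seq 0 (S (length l))))).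
  { apply FinFun.Injective_map_NoDup; [exact inj | apply seq_NoDup]. }
  assert (inc : incl (map x (seq 0 (S (length l)))) l).
  { intros a Ha. apply in_map_iff in Ha. destruct Ha as (n & <- & _). auto. }
  pose proof (NoDup_incl_length nd inc) as H.
  rewrite length_map, length_seq in H. lia.
Qed.

Lemma finite_lists {A : Type} (P : A -> Prop) (n : nat) :
  finite_set P -> finite_set (fun l : list A => length l <= n /\ Forall P l).
Proof.
  intros HP. induction n as [|n IH].
  - exists [[]]. intros [|a l] [H _]; [now left | simpl in H; lia].
  - refine (finite_sub _ _ (finite_or _ _ (finite_In [[]])
      (finite_bind _ (fun l l' => exists a, P a /\ l' = a :: l) IH _)) _).
    + intros l _. apply finite_image with (f := fun a => a :: l). exact HP.
    + intros [|a l] [Hl HF]; [left; now left | right].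
      inversion HF; subst. exists l. simpl in Hl. split; [split; [lia | auto] | eauto].
Qed.

(** Each term is chosen against the list of all earlier ones, so [R] can demand freshness and can
    read the stage off as [length l]. *)
Lemma greedy_sequence {A : Type} (R : list A -> A -> Prop) :
  (forall l, exists x, R l x) ->
  exists x : nat -> A, forall n, R (map x (seq 0 n)) (x n).
Proof.
  intros H. destruct (choice_fun _ H) as [c Hc].
  pose (L := fix L n := match n with 0 => [] | S n => L n ++ [c (L n)] end).
  exists (fun n => c (L n)). intros n.
  replace (map (fun n => c (L n)) (seq 0 n)) with (L n); [apply Hc |].
  induction n as [|n IH]; [reflexivity |].
  rewrite seq_S, map_app, <- IH. reflexivity.
Qed.

Lemma map_seq_In {A : Type} (x : nat -> A) n m : m < n -> In (x m) (map x (seq 0 n)).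
Proof. intros H. apply in_map, in_seq. lia. Qed.

Lemma fresh_sequence_injective {A : Type} (x : nat -> A) :
  (forall n, ~ In (x n) (map x (seq 0 n))) -> injective x.
Proof.
  intros H m n E. destruct (lt_eq_lt_dec m n) as [[L | L] | L]; [exfalso | exact L | exfalso].
  - apply (H n). rewrite <- E. now apply map_seq_In.
  - apply (H m). rewrite E. now apply map_seq_In.
Qed.

Lemma distinct_representatives {A : Type} (W : nat -> A -> Prop) :
  (forall n, ~ finite_set (W n)) ->
  exists x : nat -> A, injective x /\ forall n, W n (x n).
Proof.
  intros H.
  destruct (greedy_sequence (fun l x => W (length l) x /\ ~ In x l)) as [x Hx].
  { intros l. apply infinite_fresh, H. }
  exists x. split.
  - apply fresh_sequence_injective. intros n. apply Hx.
  - intros n. specialize (Hx n). rewrite length_map, length_seq in Hx. apply Hx.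
Qed.

Lemma least_index {A : Type} (idx : A -> nat) (P : A -> Prop) :
  (exists x, P x) -> exists x, P x /\ forall y, P y -> idx x <= idx y.
Proof.
  intros [x Px]. remember (idx x) as n eqn:E. revert x Px E.
  induction n as [n IH] using lt_wf_ind. intros x Px E.
  destruct (classic (exists y, P y /\ idx y < n)) as [(y & Py & L) | N].
  - exact (IH (idx y) L y Py eq_refl).
  - exists x. split; [exact Px |]. intros y Py.
    destruct (le_lt_dec (idx x) (idx y)); [assumption |].
    exfalso. apply N. exists y. split; [exact Py | lia].
Qed.

Lemma infinite_enumeration {A : Type} (idx : A -> nat) (P : A -> Prop) :
  injective idx -> ~ finite_set P ->
  exists x : nat -> A, injective x /\ (forall n, P (x n)) /\
    forall y, P y -> exists n, x n = y.
Proof.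
  intros inj HP.
  destruct (greedy_sequence (fun l x => (P x /\ ~ In x l) /\
     forall y, P y /\ ~ In y l -> idx x <= idx y)) as [x Hx].
  { intros l. apply least_index with (P := fun x => P x /\ ~ In x l).
    now apply infinite_fresh. }
  assert (injx : injective x) by (apply fresh_sequence_injective; intros n; apply Hx).
  exists x. split; [exact injx | split; [intros n; apply Hx |]].
  intros y Py. apply NNPP. intros N.
  apply (infinite_of_sequence (fun z => idx z < S (idx y)) x injx).
  - intros n. destruct (Hx n) as [_ H]. specialize (H y).
    assert (idx (x n) <= idx y); [| lia].
    apply H. split; [exact Py |]. intros I. apply in_map_iff in I.
    destruct I as (m & E & _). eauto.
  - apply finite_preimage with (P := fun n => n < S (idx y)); [exact inj | apply finite_lt].
Qed.

(** * Involutions from matchings and permutations from colourings *)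

Lemma involution_of_matching {A : Type} (R : A -> A -> Prop) :
  (forall x y, R x y -> R y x) -> (forall x y z, R x y -> R x z -> y = z) ->
  exists f : A -> A, (forall x, f (f x) = x) /\ (forall x y, R x y -> f x = y) /\
    (forall x, (forall y, ~ R x y) -> f x = x).
Proof.
  intros sym fct.
  destruct (choice_fun (fun x y => R x y \/ ((forall z, ~ R x z) /\ y = x))) as [f Hf].
  { intros x. destruct (classic (exists y, R x y)) as [[y Hy] | N]; [eauto |].
    exists x. right. split; [| reflexivity]. intros z Hz. eauto. }
  assert (H1 : forall x y, R x y -> f x = y).
  { intros x y Hxy. destruct (Hf x) as [H | [H _]]; [eauto |]. destruct (H _ Hxy). }
  assert (H2 : forall x, (forall y, ~ R x y) -> f x = x).
  { intros x N. destruct (Hf x) as [H | [_ H]]; [destruct (N _ H) | exact H]. }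
  exists f. split; [| split; assumption].
  intros x. destruct (Hf x) as [H | [H _]]; [apply H1; auto |].
  rewrite (H2 x H). auto.
Qed.

(** Corresponding colour classes are both countably infinite, so the element of rank [r x] in its
    class goes to the element of that rank in the class of the same colour. *)
Lemma color_matching_permutation {T I : Type} (idx : T -> nat) (c c' : T -> I) :
  injective idx ->
  (forall i, ~ finite_set (fun x => c x = i)) ->
  (forall i, ~ finite_set (fun x => c' x = i)) ->
  exists p, Sym p /\ forall x, c' (p x) = c x.
Proof.
  intros inj Hc Hc'.
  destruct (choice_fun _ (fun i => infinite_enumeration idx _ inj (Hc i))) as [E HE].
  destruct (choice_fun _ (fun i => infinite_enumeration idx _ inj (Hc' i))) as [E' HE'].
  destruct (choice_fun (fun x n => E (c x) n = x)) as [r Hr].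
  { intros x. destruct (HE (c x)) as (_ & _ & H). now apply H. }
  assert (col : forall x, c' (E' (c x) (r x)) = c x).
  { intros x. destruct (HE' (c x)) as (_ & H & _). apply H. }
  exists (fun x => E' (c x) (r x)). split; [| exact col].
  apply bijection_Sym.
  - intros x y Exy.
    assert (Cxy : c x = c y) by (rewrite <- (col x), <- (col y), Exy; reflexivity).
    rewrite <- (Hr x), <- (Hr y). rewrite Cxy in *. f_equal.
    destruct (HE' (c y)) as (H & _ & _). now apply H.
  - intros y. destruct (HE' (c' y)) as (_ & _ & H).
    destruct (H y eq_refl) as [n Hn]. destruct (HE (c' y)) as (H1 & H2 & _).
    exists (E (c' y) n). rewrite H2.
    replace (r (E (c' y) n)) with n; [exact Hn |].
    apply H1. pose proof (Hr (E (c' y) n)) as K. rewrite H2 in K. now rewrite K.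
Qed.

(** The sets [Z i] may overlap. Distinct points are chosen in pairs that visit the [k] sets
    cyclically, and [D] is true exactly at the first point of each pair. *)
Lemma splitting_coloring {T : Type} (Z : nat -> T -> Prop) (k : nat) :
  (forall i, i < k -> ~ finite_set (Z i)) ->
  exists D : T -> bool, forall i b, i < k -> ~ finite_set (fun x => Z i x /\ D x = b).
Proof.
  intros HZ. destruct (Nat.eq_dec k 0) as [-> | Hk].
  { exists (fun _ => true). intros; lia. }
  destruct (distinct_representatives (fun n => Z (n / 2 mod k))) as (x & inj & Hx).
  { intros n. apply HZ, Nat.mod_upper_bound, Hk. }
  destruct (choice_fun (fun z b => b = true <-> exists n, z = x (2 * n))) as [D HD].
  { intros z. destruct (classic (exists n, z = x (2 * n))) as [H | H];
      [exists true | exists false]; split; intros; congruence || auto. }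
  exists D. intros i b Hi.
  apply infinite_of_sequence with (x := fun m => x (2 * (i + m * k) + if b then 0 else 1)).
  - intros m m' E. apply inj in E. assert (m * k = m' * k) by lia. nia.
  - intros m. split.
    + set (n := 2 * (i + m * k) + if b then 0 else 1).
      specialize (Hx n). replace (n / 2 mod k) with i in Hx; [exact Hx |].
      replace (n / 2) with (i + m * k).
      * rewrite Nat.Div0.mod_add. now rewrite Nat.mod_small.
      * unfold n. destruct b; [apply Nat.div_unique with 0 | apply Nat.div_unique with 1]; lia.
    + destruct b.
      * apply HD. exists (i + m * k). f_equal. lia.
      * apply not_true_is_false. intros H. apply HD in H. destruct H as [n H].
        apply inj in H. lia.
Qed.

(** * Pointwise finite families *)

Lemma subgroup_inverse {T : Type} (H : (T -> T) -> Prop) f g :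
  is_subgroup H -> inverses f g -> H f -> H g.
Proof.
  intros (_ & ext & _ & _ & inv) [_ fg] Hf.
  destruct (inv f Hf) as (c & Hc & cf & _).
  apply ext with c; [| exact Hc]. intros x. rewrite <- (fg x) at 1. apply cf.
Qed.

Lemma Sym_subgroup (T : Type) : is_subgroup (@Sym T).
Proof.
  split; [auto | split; [| split; [| split]]].
  - intros a b E (c & H1 & H2). exists c.
    split; intros x; [rewrite <- E | rewrite <- E]; auto.
  - exists (fun x => x). auto.
  - intros a b (a' & A1 & A2) (b' & B1 & B2). exists (fun x => a' (b' x)).
    split; intros x; [rewrite B1 | rewrite A2]; auto.
  - intros a (c & H1 & H2). exists c. split; [exists a |]; auto.
Qed.

Lemma generated_subgroup {T : Type} (A : (T -> T) -> Prop) :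
  (forall a, A a -> Sym a) -> is_subgroup (generated A).
Proof.
  intros HA.
  assert (S : forall h, generated A h -> Sym h).
  { intros h Hh. apply Hh; [apply Sym_subgroup | exact HA]. }
  split; [exact S | split; [| split; [| split]]].
  - intros a b E Ha H HH HAH. assert (K := Ha H HH HAH).
    destruct HH as (_ & ext & _). now apply ext with a.
  - intros H HH _. apply HH.
  - intros a b Ha Hb H HH HAH. apply HH; [apply Ha | apply Hb]; assumption.
  - intros a Ha. destruct (S a Ha) as [c Hc]. exists c. split; [| exact Hc].
    intros H HH HAH. apply (subgroup_inverse H a c HH Hc). now apply Ha.
Qed.

Lemma generated_incl {T : Type} (A : (T -> T) -> Prop) a : A a -> generated A a.
Proof. intros Ha H _ HA. auto. Qed.

Lemma list_enumeration : exists d : nat -> list nat, forall l, exists n, d n = l.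
Proof.
  pose (D := fix D k n := match k with
     | 0 => [] | S k => fst (of_nat n) :: D k (snd (of_nat n)) end).
  exists (fun n => D (fst (of_nat n)) (snd (of_nat n))).
  intros l.
  assert (H : exists n, D (length l) n = l).
  { induction l as [|a l [n IH]]; [now exists 0 |].
    exists (to_nat (a, n)).
    change (fst (of_nat (to_nat (a, n))) :: D (length l) (snd (of_nat (to_nat (a, n)))) = a :: l).
    rewrite cancel_of_to. now rewrite <- IH at 2. }
  destruct H as [n H]. exists (to_nat (length l, n)). now rewrite cancel_of_to.
Qed.

(** A letter stands for a whole set [P n] of permutations, so a list describes a product of sets;
    countably many lists can cover uncountably many permutations. *)
Fixpoint word {T : Type} (P : nat -> (T -> T) -> Prop) (l : list nat) (f : T -> T) : Prop :=
  match l with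
  | [] => forall x, f x = x
  | n :: l => exists p w, P n p /\ word P l w /\ forall x, f x = p (w x)
  end.

Lemma word_app {T : Type} (P : nat -> (T -> T) -> Prop) l m f g :
  word P l f -> word P m g -> word P (l ++ m) (fun x => f (g x)).
Proof.
  revert f. induction l as [|n l IH]; intros f Hf Hg; simpl in *.
  - destruct m as [|n m]; simpl in *.
    + intros x. now rewrite Hf.
    + destruct Hg as (p & w & Hp & Hw & E). exists p, w.
      repeat split; auto. intros x. now rewrite Hf.
  - destruct Hf as (p & w & Hp & Hw & E). exists p, (fun x => w (g x)). auto.
Qed.

Lemma word_subgroup {T : Type} (P : nat -> (T -> T) -> Prop) :
  (forall n p, P n p -> exists m q, P m q /\ inverses p q) ->
  is_subgroup (fun f => Sym f /\ exists l, word P l f).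
Proof.
  intros inv.
  assert (ext : forall l a b, (forall x, a x = b x) -> word P l a -> word P l b).
  { intros [|n l] a b E; simpl.
    - intros H x. now rewrite <- E.
    - intros (p & w & Hp & Hw & K). exists p, w. repeat split; auto.
      intros x. now rewrite <- E. }
  destruct (Sym_subgroup T) as (_ & Sext & Sid & Scomp & Sinv).
  split; [tauto | split; [| split; [| split]]].
  - intros a b E [Sa [l Hl]]. split; [now apply Sext with a | exists l; now apply ext with a].
  - split; [exact Sid | now exists []].
  - intros a b [Sa [l Hl]] [Sb [m Hm]]. split; [auto |].
    exists (m ++ l). now apply word_app.
  - intros a [Sa [l Hl]]. destruct (Sinv a Sa) as (c & Sc & ca & ac).
    exists c. split; [split; [exact Sc |] | auto].
    assert (H : exists m c, word P m c /\ inverses a c).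
    { clear c Sa Sc ca ac. revert a Hl. induction l as [|n l IH]; simpl; intros a Hl.
      - exists [], (fun x => x). split; [now simpl | split; auto].
      - destruct Hl as (p & w & Hp & Hw & E).
        destruct (IH w Hw) as (m & v & Hv & wv & vw).
        destruct (inv n p Hp) as (k & q & Hq & qp & pq).
        exists (m ++ [k]), (fun x => v (q x)). split; [| split].
        + apply word_app; [exact Hv |]. simpl. exists q, (fun x => x). auto.
        + intros x. now rewrite E, qp.
        + intros x. now rewrite E, vw. }
    destruct H as (m & c' & Hm & c'a & ac'). exists m.
    apply ext with c'; [| exact Hm]. intros x. rewrite <- (ac x) at 1. apply c'a.
Qed.

Lemma word_pointwise_finite {T : Type} (P : nat -> (T -> T) -> Prop) l x :
  (forall n y, finite_set (fun z => exists p, P n p /\ z = p y)) ->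
  finite_set (fun z => exists f, word P l f /\ z = f x).
Proof.
  intros fin. induction l as [|n l IH].
  - exists [x]. intros z (f & Hf & ->). simpl in Hf. left. now rewrite Hf.
  - refine (finite_sub _ _ (finite_bind _ (fun y z => exists p, P n p /\ z = p y) IH _) _).
    + intros y _. apply fin.
    + intros z (f & (p & w & Hp & Hw & E) & ->). exists (w x). split; eauto.
Qed.

(** Diagonalisation: stage [n] swaps a fresh [x] with a fresh [y] outside the finite set [F n x].
    The pairs are disjoint, so the swaps form one involution. *)
Lemma evading_involution {T : Type} (F : nat -> T -> T -> Prop) :
  ~ finite_set (fun _ : T => True) -> (forall n x, finite_set (F n x)) ->
  exists f : T -> T, (forall x, f (f x) = x) /\ forall n, exists x, ~ F n x (f x).
Proof.
  intros infT fin.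
  destruct (greedy_sequence (fun (l : list (T * T)) xy =>
     let used := map fst l ++ map snd l in
     ~ In (fst xy) used /\ ~ In (snd xy) used /\ fst xy <> snd xy /\
     ~ F (length l) (fst xy) (snd xy))) as [s Hs].
  { intros l. set (used := map fst l ++ map snd l).
    destruct (infinite_fresh _ infT used) as (x & _ & Hx).
    destruct (fin (length l) x) as [m Hm].
    destruct (infinite_fresh _ infT (x :: used ++ m)) as (y & _ & Hy).
    exists (x, y). simpl in *. rewrite in_app_iff in Hy.
    split; [exact Hx | split; [tauto | split; [tauto |]]].
    intros K. apply Hm in K. tauto. }
  assert (fresh : forall m n, m < n ->
     fst (s n) <> fst (s m) /\ fst (s n) <> snd (s m) /\
     snd (s n) <> fst (s m) /\ snd (s n) <> snd (s m)).
  { intros m n L. destruct (Hs n) as (H1 & H2 & _). rewrite in_app_iff in H1, H2.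
    pose proof (map_seq_In s n m L) as I.
    pose proof (in_map fst _ _ I). pose proof (in_map snd _ _ I).
    repeat split; intros E; rewrite E in *; tauto. }
  destruct (involution_of_matching (fun x y => exists n, s n = (x, y) \/ s n = (y, x)))
    as (f & ff & Hf & _).
  - intros x y [n H]. exists n. tauto.
  - intros x y z [m H] [n K].
    destruct (lt_eq_lt_dec m n) as [[L | ->] | L].
    + exfalso. destruct (fresh m n L) as (A & B & C & D).
      destruct H as [H | H], K as [K | K]; rewrite H, K in *; simpl in *; congruence.
    + destruct (Hs n) as (_ & _ & D & _).
      destruct H as [H | H], K as [K | K]; rewrite H in *; simpl in *; congruence.
    + exfalso. destruct (fresh n m L) as (A & B & C & D).
      destruct H as [H | H], K as [K | K]; rewrite H, K in *; simpl in *; congruence.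
  - exists f. split; [exact ff |]. intros n. exists (fst (s n)).
    rewrite (Hf _ (snd (s n))).
    + destruct (Hs n) as (_ & _ & _ & H). now rewrite length_map, length_seq in H.
    + exists n. left. now destruct (s n).
Qed.

(** The permutations described by words form a subgroup containing every [P n]. There are countably
    many words, each moving a point to finitely many places, so one involution escapes them all. *)
Lemma pointwise_finite_family_not_generating {T : Type} (P : nat -> (T -> T) -> Prop) :
  ~ finite_set (fun _ : T => True) ->
  (forall n p, P n p -> Sym p) ->
  (forall n p, P n p -> exists m q, P m q /\ inverses p q) ->
  (forall n y, finite_set (fun z => exists p, P n p /\ z = p y)) ->
  exists f, Sym f /\ ~ generated (fun p => exists n, P n p) f.
Proof.
  intros infT HS inv fin. destruct list_enumeration as [d Hd].
  destruct (evading_involution (fun n x y => exists f, word P (d n) f /\ y = f x) infT)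
    as (f & ff & Hf).
  { intros n x. now apply word_pointwise_finite. }
  exists f. split; [now apply involution_Sym |]. intros Gf.
  destruct (Gf _ (word_subgroup P inv)) as [_ [l Hl]].
  - intros a [n Ha]. split; [eauto |]. exists [n]. simpl. exists a, (fun x => x). auto.
  - destruct (Hd l) as [n <-]. destruct (Hf n) as [x Hx]. apply Hx. eauto.
Qed.

(* The cosets of the pointwise stabiliser of [Gamma] in [G] are indexed by the
   images of [Gamma], hence by [nat]; each of them moves a point to finitely many places. *)
Lemma finite_orbits_not_full {T : Type} (G : (T -> T) -> Prop) (Gamma : list T) :
  countably_infinite T -> is_subgroup G ->
  (forall x, finite_set (orbit (ptstab G (fun y => In y Gamma)) x)) ->
  ~ preceq (@Sym T) G.
Proof.
  intros (e & einj & esurj) HG fin (U & [us Hus] & HU & gen).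
  destruct list_enumeration as [d Hd].
  assert (HGc := HG). destruct HGc as (GS & Gext & Gid & Gcomp & Ginv).
  (* The number [n] codes at once a coset, by the images [map e (d n)] of [Gamma], and the generator
     at position [n] of [us] together with its inverse. *)
  pose (P := fun n f => (G f /\ map f Gamma = map e (d n)) \/
     (Sym f /\ exists u, nth_error us n = Some u /\ ((forall x, f x = u x) \/ inverses u f))).
  assert (HPS : forall n p, P n p -> Sym p).
  { intros n p [[H _] | [H _]]; auto. }
  assert (PG : forall g, G g -> exists n, P n g).
  { intros g Hg. destruct (choice_fun _ esurj) as [i Hi].
    destruct (Hd (map i (map g Gamma))) as [n Hn]. exists n. left. split; [exact Hg |].
    rewrite Hn, !map_map. apply map_ext. intros x. now rewrite Hi. }
  assert (PU : forall u, U u -> exists n, P n u).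
  { intros u Hu. destruct (In_nth_error us u (Hus u Hu)) as [n Hn].
    exists n. right. split; eauto. }
  destruct (pointwise_finite_family_not_generating P) as (f & Sf & Nf).
  - apply infinite_of_sequence with e; [exact einj | auto].
  - exact HPS.
  - intros n p [[Hg _] | [[q Hq] (u & Hn & Hu)]].
    + destruct (Ginv p Hg) as (c & Hc & cp). destruct (PG c Hc) as [m Hm].
      exists m, c. now split.
    + exists n, q. split; [| exact Hq]. right. split.
      * exists p. now apply inverses_sym.
      * exists u. split; [exact Hn |]. destruct Hq as [qp pq]. destruct Hu as [Hu | [pu _]].
        -- right. split; intros x; [rewrite <- Hu | rewrite <- Hu]; auto.
        -- left. intros x. rewrite <- (pu x) at 1. apply qp.
  - intros n y.
    apply finite_sub with (fun z =>
      (exists p, (G p /\ map p Gamma = map e (d n)) /\ z = p y) \/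
      (exists p u, (nth_error us n = Some u /\ Sym u /\
         ((forall x, p x = u x) \/ inverses u p)) /\ z = p y)); cycle 1.
    { intros z (p & [Hp | (Sp & u & Hn & Hu)] & ->); [left; eauto | right].
      exists p, u. repeat split; auto.
      destruct Hu as [Hu | Hu]; [| exists p; exact Hu].
      destruct (Sym_subgroup T) as (_ & Sext & _). now apply Sext with p. }
    apply finite_or.
    + destruct (classic (exists g, G g /\ map g Gamma = map e (d n))) as [(g & Hg & Eg) | N].
      * destruct (Ginv g Hg) as (g' & Hg' & g'g & gg').
        (* Following [p] by the inverse of a fixed [g] in the same coset fixes [Gamma], so [p y]
           lies in the [g]-image of the finite orbit of [y]. *)
        refine (finite_sub _ _ (finite_image g _ (fin y)) _).
        intros z (p & [Hp Ep] & ->). exists (g' (p y)). split; [| now rewrite gg'].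
        exists (fun x => g' (p x)). split; [| reflexivity]. split; [now apply Gcomp |].
        intros x Hx. rewrite <- Eg in Ep.
        rewrite (ext_in_map Ep x Hx). apply g'g.
      * exists []. intros z (p & Hp & _). apply N. eauto.
    + destruct (nth_error us n) as [u |].
      * destruct (classic (Sym u)) as [[v [vu uv]] | N].
        -- exists [u y; v y]. intros z (p & u' & (Hn & _ & Hu) & ->). injection Hn as <-.
           destruct Hu as [Hu | [pu _]]; [left; auto | right; left].
           rewrite <- (uv y) at 2. now rewrite pu.
        -- exists []. intros z (p & u' & (Hn & Su & _) & _). injection Hn as <-. contradiction.
      * exists []. intros z (p & u' & (Hn & _) & _). discriminate.
  - apply Nf. intros H HH HP. apply (gen f Sf H HH). intros h [Hh | Hh].
    + apply HP. now apply PG.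
    + apply HP. now apply PU.
Qed.

(** * From a moiety to the full symmetric group *)

(* A permutation that carries infinitely many points from each side of [chi] to
   each side is determined up to factors preserving [chi], so it suffices to have
   one such permutation [t]; any [f] is a quotient of two of them. *)
Lemma moiety_generates {T : Type} (idx : T -> nat) (chi : T -> bool) :
  injective idx -> (forall b, ~ finite_set (fun x => chi x = b)) ->
  exists d t, Sym d /\ Sym t /\
    forall H, is_subgroup H -> H d -> H t ->
    (forall w, Sym w -> (forall x, chi x = false -> w x = x) -> H w) ->
    forall f, Sym f -> H f.
Proof.
  intros inj inf.
  destruct (color_matching_permutation idx chi (fun x => negb (chi x)) inj inf)
    as (d & Sd & Hd).
  { intros b K. apply (inf (negb b)). refine (finite_sub _ _ K _).
    intros x ->. apply negb_involutive. }
  assert (split_perm : forall D : T -> bool,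
    (forall b, ~ finite_set (fun x => D x = b)) ->
    exists p, Sym p /\ forall x, chi (p x) = D x).
  { intros D HD. now apply color_matching_permutation with idx. }
  (* [D0] halves each side of [chi], so [t], which carries [D0] to [chi], sends infinitely many
     points from each side to each side. *)
  destruct (splitting_coloring (fun i x => chi x = Nat.eqb i 0) 2) as [D0 HD0].
  { intros i _. apply inf. }
  assert (HD0' : forall a b, ~ finite_set (fun x => chi x = a /\ D0 x = b)).
  { intros [] b; [apply (HD0 0) | apply (HD0 1)]; lia. }
  destruct (split_perm D0) as (t & St & Ht).
  { intros b K. apply (HD0' true b). refine (finite_sub _ _ K _). tauto. }
  exists d, t. split; [exact Sd | split; [exact St |]].
  intros H HH Hd' Ht' Hsupp.
  assert (HHc := HH). destruct HHc as (_ & ext & _ & comp & _).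
  (* [w1] and [w2] are the parts of [w] on the two sides; conjugation by [d], which exchanges the
     sides, moves [w2] to the side where every permutation is available. *)
  assert (pres : forall w, Sym w -> (forall x, chi (w x) = chi x) -> H w).
  { intros w (v & vw & wv) Hw.
    assert (Hv : forall x, chi (v x) = chi x).
    { intros x. rewrite <- (wv x) at 2. now rewrite Hw. }
    pose (w1 := fun x => if chi x then w x else x).
    pose (w2 := fun x => if chi x then x else w x).
    assert (H1 : H w1).
    { apply Hsupp.
      - exists (fun x => if chi x then v x else x). unfold w1. split; intros x;
          destruct (chi x) eqn:E; rewrite ?Hw, ?Hv, ?E; auto.
      - intros x E. unfold w1. now rewrite E. }
    destruct Sd as (d' & d'd & dd').
    assert (Hd'chi : forall x, chi (d' x) = negb (chi x)).
    { intros x. rewrite <- (dd' x) at 2. rewrite Hd. reflexivity. }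
    assert (Hdchi : forall x, chi (d x) = negb (chi x)).
    { intros x. rewrite <- (Hd x). now rewrite negb_involutive. }
    assert (Hinv : H d') by (apply (subgroup_inverse H d d' HH); [split |]; auto).
    assert (H2 : H (fun x => d' (w2 (d x)))).
    { apply Hsupp.
      - exists (fun x => d' ((fun x => if chi x then x else v x) (d x))). unfold w2.
        split; intros x; rewrite dd', Hdchi; destruct (chi x) eqn:E; simpl;
          rewrite ?Hw, ?Hv, ?Hdchi, ?E; simpl; rewrite ?vw, ?wv; auto.
      - intros x E. unfold w2. rewrite Hdchi, E. simpl. auto. }
    apply ext with (fun x => w1 (d (d' (w2 (d (d' x)))))).
    - intros x. rewrite !dd'. unfold w1, w2. destruct (chi x) eqn:E.
      + now rewrite E.
      + now rewrite Hw, E.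
    - apply (comp (fun x => d (d' (w2 (d (d' x))))) w1); [| exact H1].
      apply (comp (fun x => d' (w2 (d (d' x)))) d); [| exact Hd'].
      apply (comp d' (fun x => d' (w2 (d x)))); assumption. }
  (* [l] matches the four classes given by the sides of [x] and [f x] with those for [t]; then [f]
     is [l], followed by [t] and a third factor, where [l] and the third factor preserve [chi]. *)
  assert (generic : forall f, Sym f ->
     (forall a b, ~ finite_set (fun x => chi x = a /\ chi (f x) = b)) -> H f).
  { intros f Sf Hf.
    destruct (color_matching_permutation idx
      (fun x => (chi x, chi (f x))) (fun x => (chi x, chi (t x))) inj) as (l & Sl & Hl).
    - intros [a b] K. apply (Hf a b). refine (finite_sub _ _ K _). intros x [<- <-]. auto.
    - intros [a b] K. apply (HD0' a b). refine (finite_sub _ _ K _).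
      intros x [<- <-]. now rewrite Ht.
    - assert (Hl1 : forall x, chi (l x) = chi x) by (intros x; specialize (Hl x); congruence).
      assert (Hl2 : forall x, chi (t (l x)) = chi (f x)).
      { intros x; specialize (Hl x); congruence. }
      assert (Hlin : H l) by now apply pres.
      destruct Sl as (l' & l'l & ll'), St as (t' & t't & tt'), Sf as (f' & f'f & ff').
      assert (Hm : H (fun x => f (l' (t' x)))).
      { apply pres.
        - exists (fun x => t (l (f' x))). split; intros x.
          + now rewrite f'f, ll', tt'.
          + now rewrite t't, l'l, ff'.
        - intros x. rewrite <- Hl2. now rewrite ll', tt'. }
      apply ext with (fun x => (fun y => f (l' (t' y))) (t (l x))).
      + intros x. now rewrite t't, l'l.
      + apply (comp (fun x => t (l x)) (fun y => f (l' (t' y)))); [| exact Hm]. now apply (comp l t). }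
  intros f Sf. assert (Sfc := Sf). destruct Sfc as (f' & f'f & ff').
  (* The four sets to be halved are the two sides of [chi] ([i] is 0 or 1) and their images under
     [f] ([i] is 2 or 3). Then [p] and [f] followed by [p] are both generic. *)
  destruct (splitting_coloring (fun i x =>
     if i <? 2 then chi x = Nat.eqb i 0 else chi (f' x) = Nat.eqb i 2) 4) as [D HD].
  { intros i _. destruct (i <? 2); [apply inf |]. intros K.
    apply (inf (i =? 2)).
    apply finite_sub with (fun x => chi (f' (f x)) = (i =? 2)).
    - apply finite_preimage with (f := f) (P := fun y => chi (f' y) = (i =? 2)); [| exact K].
      now apply Sym_injective.
    - intros x. now rewrite f'f. }
  assert (HD1 : forall a b, ~ finite_set (fun x => chi x = a /\ D x = b)).
  { intros [] b; [apply (HD 0) | apply (HD 1)]; lia. }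
  assert (HD2 : forall a b, ~ finite_set (fun x => chi (f' x) = a /\ D x = b)).
  { intros [] b; [apply (HD 2) | apply (HD 3)]; lia. }
  destruct (split_perm D) as (p & Sp & Hp).
  { intros b K. apply (HD1 true b). refine (finite_sub _ _ K _). tauto. }
  assert (Hpin : H p).
  { apply generic; [exact Sp |]. intros a b K. apply (HD1 a b).
    refine (finite_sub _ _ K _). intros x. now rewrite Hp. }
  assert (Hpf : H (fun x => p (f x))).
  { apply generic.
    - now apply (Sym_subgroup T).
    - intros a b K. apply (HD2 a b).
      apply finite_sub with (fun x => chi (f' x) = a /\ chi (p (f (f' x))) = b).
      + apply finite_preimage with (f := f') (P := fun x => chi x = a /\ chi (p (f x)) = b);
          [| exact K].
        apply Sym_injective. exists f. now split.
      + intros x. now rewrite ff', Hp. }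
  destruct Sp as (p' & p'p & pp').
  apply ext with (fun x => p' ((fun y => p (f y)) x)).
  - intros x. now rewrite p'p.
  - apply (comp (fun y => p (f y)) p'); [exact Hpf |].
    apply (subgroup_inverse H p p' HH); [split |]; auto.
Qed.

(** * Permutations acting along a sequence of points *)

Lemma extend_along {T : Type} (gam : nat -> T) (phi psi : nat -> nat) :
  injective gam -> inverses phi psi ->
  exists z z', inverses z z' /\
    (forall j, z (gam j) = gam (phi j)) /\ (forall j, z' (gam j) = gam (psi j)) /\
    (forall x, (forall j, x <> gam j) -> z x = x /\ z' x = x).
Proof.
  intros inj [psiphi phipsi].
  assert (ex : forall th : nat -> nat, exists f : T -> T,
    (forall j, f (gam j) = gam (th j)) /\ (forall x, (forall j, x <> gam j) -> f x = x)).
  { intros th. destruct (choice_fun (fun x y => (forall j, x = gam j -> y = gam (th j)) /\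
      ((forall j, x <> gam j) -> y = x))) as [f Hf].
    - intros x. destruct (classic (exists j, x = gam j)) as [[j ->] | N].
      + exists (gam (th j)). split.
        * intros k E. now apply inj in E as ->.
        * intros K. now destruct (K j).
      + exists x. split; [| auto]. intros j E. destruct N. eauto.
    - exists f. split; intros; now apply Hf. }
  destruct (ex phi) as (z & z1 & z2), (ex psi) as (z' & z1' & z2').
  exists z, z'. split; [| auto].
  assert (cases : forall x, (exists j, x = gam j) \/ forall j, x <> gam j).
  { intros x. destruct (classic (exists j, x = gam j)) as [H | H]; [now left | right].
    intros j E. eauto. }
  split; intros x; destruct (cases x) as [[j ->] | N].
  - now rewrite z1, z1', psiphi.
  - now rewrite z2, z2'.
  - now rewrite z1', z1, phipsi.
  - now rewrite z2', z2.
Qed.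

(* [nat] lists the rows of [Z x nat] as [0, 2, 4, ...] (nonnegative) and [1, 3, ...] (negative). *)
Definition next_row (r : nat) : nat :=
  if Nat.even r then 2 + r else if r =? 1 then 0 else r - 2.

Definition previous_row (r : nat) : nat :=
  if Nat.even r then if r =? 0 then 1 else r - 2 else 2 + r.

Lemma even_minus_2 r : 2 <= r -> Nat.even (r - 2) = Nat.even r.
Proof. intros H. destruct r as [|[|r]]; try lia. simpl. now rewrite Nat.sub_0_r. Qed.

Lemma row_inverses : inverses next_row previous_row.
Proof.
  split; intros r; unfold next_row, previous_row.
  - destruct (Nat.even r) eqn:E.
    + change (Nat.even (2 + r)) with (Nat.even r). rewrite E. simpl. lia.
    + destruct (Nat.eqb_spec r 1) as [-> | N]; [reflexivity |].
      destruct r as [|[|r]]; try discriminate; try lia.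
      rewrite even_minus_2, E by lia. lia.
  - destruct (Nat.even r) eqn:E.
    + destruct (Nat.eqb_spec r 0) as [-> | N]; [reflexivity |].
      destruct r as [|[|r]]; try discriminate; try lia.
      rewrite even_minus_2, E by lia. lia.
    + change (Nat.even (2 + r)) with (Nat.even r). rewrite E. simpl. lia.
Qed.

(* If [a] acts as [w] on the nonnegative rows and [z] shifts the rows, then
   [a z a^-1 z^-1] is [w] on row [0] and the identity elsewhere. *)
Lemma full_set_supports {T : Type} (gam : nat -> T) :
  injective gam ->
  exists z, Sym z /\
    forall H, is_subgroup H -> H z ->
    (forall phi psi, inverses phi psi -> exists h, H h /\ forall j, h (gam j) = gam (phi j)) ->
    forall w, Sym w -> (forall x, (forall i, x <> gam (to_nat (0, i))) -> w x = x) -> H w.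
Proof.
  intros inj.
  pose (act := fun (q : nat -> nat -> nat * nat) n =>
     to_nat (q (fst (of_nat n)) (snd (of_nat n)))).
  assert (actE : forall q r i, act q (to_nat (r, i)) = to_nat (q r i)).
  { intros q r i. unfold act. now rewrite cancel_of_to. }
  assert (actI : forall q q', (forall r i, q' (fst (q r i)) (snd (q r i)) = (r, i)) ->
     forall n, act q' (act q n) = n).
  { intros q q' K n. rewrite <- (cancel_to_of n). destruct (of_nat n) as [r i].
    rewrite actE, <- (K r i) at 1. destruct (q r i) as [r' i']. apply actE. }
  destruct row_inverses as [prevnext nextprev].
  destruct (extend_along gam (act (fun r i => (next_row r, i)))
     (act (fun r i => (previous_row r, i))) inj) as (z & z' & [z'z zz'] & Hz & Hz' & Hout).
  { split; apply actI; intros r i; simpl; now rewrite ?prevnext, ?nextprev. }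
  exists z. split; [now exists z' |].
  intros H HH Hzin full w (w' & w'w & ww') supp.
  assert (HHc := HH). destruct HHc as (_ & ext & _ & comp & inv).
  assert (supp' : forall x, (forall i, x <> gam (to_nat (0, i))) -> w' x = x).
  { intros x N. rewrite <- (supp x N) at 1. apply w'w. }
  (* A point of row 0 that [v] sent outside the row would have its image fixed by [v'], hence would
     equal that image. *)
  assert (row : forall v v' : T -> T, (forall x, v' (v x) = x) ->
     (forall x, (forall i, x <> gam (to_nat (0, i))) -> v' x = x) ->
     exists phi : nat -> nat, forall i, v (gam (to_nat (0, i))) = gam (to_nat (0, phi i))).
  { intros v v' v'v s'. apply choice_fun with
      (R := fun i k => v (gam (to_nat (0, i))) = gam (to_nat (0, k))).
    intros i. apply NNPP. intros N.
    assert (E : v' (v (gam (to_nat (0, i)))) = v (gam (to_nat (0, i)))).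
    { apply s'. intros k E. eauto. }
    rewrite v'v in E. apply N. exists i. now symmetry. }
  assert (row_inj : forall i k, gam (to_nat (0, i)) = gam (to_nat (0, k)) -> i = k).
  { intros i k E. apply inj, (f_equal of_nat) in E. rewrite !cancel_of_to in E. congruence. }
  destruct (row w w' w'w supp') as [phi Hphi].
  destruct (row w' w ww' supp) as [psi Hpsi].
  assert (psiphi : forall i, psi (phi i) = i).
  { intros i. apply row_inj. now rewrite <- Hpsi, <- Hphi, w'w. }
  assert (phipsi : forall i, phi (psi i) = i).
  { intros i. apply row_inj. now rewrite <- Hphi, <- Hpsi, ww'. }
  (* [copies phi] acts on the even rows, which are the nonnegative rows of the shift. *)
  pose (copies := fun (th : nat -> nat) (r i : nat) => (r, if Nat.even r then th i else i)).
  assert (Hcop : inverses (act (copies phi)) (act (copies psi))).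
  { split; apply actI; intros r i; unfold copies; simpl; destruct (Nat.even r); congruence. }
  destruct (full _ _ Hcop) as (h & Hh & hE).
  destruct (inv h Hh) as (h' & Hh' & h'h & hh').
  assert (h'E : forall j, h' (gam j) = gam (act (copies psi) j)).
  { intros j. destruct Hcop as [_ K]. rewrite <- (K j) at 1. rewrite <- hE. apply h'h. }
  apply ext with (fun x => h (z (h' (z' x)))).
  2:{ apply (comp (fun x => z (h' (z' x))) h); [| exact Hh].
      apply (comp (fun x => h' (z' x)) z); [| exact Hzin].
      apply (comp z' h'); [| exact Hh'].
      apply (subgroup_inverse H z z' HH); [split |]; auto. }
  intros x. destruct (classic (exists j, x = gam j)) as [[j ->] | N].
  - rewrite <- (cancel_to_of j). destruct (of_nat j) as [r i].
    rewrite Hz', actE, h'E, actE, Hz. unfold copies at 1. rewrite actE, nextprev, hE, actE.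
    unfold copies. destruct (Nat.eq_dec r 0) as [-> | Nr].
    + rewrite Hphi. reflexivity.
    + rewrite supp.
      (* Away from row 0 a row and its predecessor have the same parity, so the two factors cancel
         or are both trivial; only row 0 is even with an odd predecessor. *)
      * do 3 f_equal. unfold previous_row. destruct (Nat.even r) eqn:E.
        -- destruct (Nat.eqb_spec r 0) as [K | _]; [contradiction |].
           destruct r as [|[|r]]; try discriminate; try lia.
           rewrite even_minus_2, E by lia. apply phipsi.
        -- change (Nat.even (2 + r)) with (Nat.even r). now rewrite E.
      * intros k E. apply inj, (f_equal of_nat) in E. rewrite !cancel_of_to in E. congruence.
  - assert (N' : forall j, x <> gam j) by (intros j E; eauto).
    (* Nothing is known of the values of [h] off the sequence, but [z] is the identity there, so [h]
       and its inverse cancel. *)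
    assert (N'' : forall j, h' x <> gam j).
    { intros j E. apply (N' (act (copies phi) j)). rewrite <- hE, <- E. now rewrite hh'. }
    destruct (Hout x N') as [_ ->]. destruct (Hout (h' x) N'') as [-> _].
    rewrite hh', supp; auto.
Qed.

(** Initial segments mapped into themselves occur arbitrarily far out; for an involution this means
    that it splits into involutions of consecutive finite blocks. *)
Definition locally_bounded (s : nat -> nat) : Prop :=
  forall m, exists e, m <= e /\ forall n, n < e -> s n < e.

Lemma bounded_on_segment (f : nat -> nat) m : exists B, forall j, j < m -> f j < B.
Proof.
  induction m as [|m [B HB]]; [exists 0; intros; lia |].
  exists (B + S (f m)). intros j Hj.
  destruct (Nat.eq_dec j m) as [-> | N]; [lia |]. specialize (HB j). lia.
Qed.

(* With [e] growing fast, a pair [{2j+1, 2 phi(j)}] straddles at most one of the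
   cuts [e n]; the pairs straddling an even cut and the others are swapped in turn. *)
Lemma locally_bounded_involutions_full {T : Type} (alp : nat -> T) (H : (T -> T) -> Prop) :
  is_subgroup H ->
  (forall s, (forall n, s (s n) = n) -> locally_bounded s ->
     exists h, H h /\ forall j, h (alp j) = alp (s j)) ->
  forall phi psi, inverses phi psi ->
  exists h, H h /\ forall j, h (alp (2 * j)) = alp (2 * phi j).
Proof.
  intros HH real phi psi [psiphi phipsi].
  assert (phiinj : forall i j, phi i = phi j -> i = j).
  { intros i j E. rewrite <- (psiphi i), E. apply psiphi. }
  destruct HH as (_ & _ & _ & comp & _).
  pose (cross := fun c j => (2 * j + 1 < c /\ c <= 2 * phi j) \/ (2 * phi j < c /\ c <= 2 * j + 1)).
  (* Swapping the pairs in [Q] is locally bounded once arbitrarily large cuts are crossed by none of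
     them. *)
  assert (swap : forall Q : nat -> Prop,
     (forall m, exists e, m <= e /\ forall j, Q j -> ~ cross e j) ->
     exists h, H h /\ forall j,
       (Q j -> h (alp (2 * j + 1)) = alp (2 * phi j)) /\
       (~ Q j -> h (alp (2 * j + 1)) = alp (2 * j + 1) /\ h (alp (2 * phi j)) = alp (2 * phi j))).
  { intros Q HQ.
    destruct (involution_of_matching (fun x y => exists j, Q j /\
      ((x = 2 * j + 1 /\ y = 2 * phi j) \/ (x = 2 * phi j /\ y = 2 * j + 1))))
      as (s & ss & sR & sN).
    - intros x y (j & Hj & K). exists j. tauto.
    - intros x y y' (j & Hj & K) (j' & Hj' & K').
      assert (j = j'); [| subst; lia].
      destruct K as [[-> ->] | [-> ->]], K' as [[E ->] | [E ->]]; try lia.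
      apply phiinj. lia.
    - destruct (real s ss) as (h & Hh & hE).
      + intros m. destruct (HQ m) as (e & Le & He). exists e. split; [exact Le |].
        intros n Ln. destruct (classic (exists y, exists j, Q j /\
          ((n = 2 * j + 1 /\ y = 2 * phi j) \/ (n = 2 * phi j /\ y = 2 * j + 1))))
          as [[y Hy] | N].
        * rewrite (sR n y Hy). destruct Hy as (j & Hj & K).
          specialize (He j Hj). unfold cross in He. lia.
        * rewrite sN; [exact Ln |]. intros y Hy. eauto.
      + exists h. split; [exact Hh |]. intros j. rewrite !hE. split.
        * intros Hj. f_equal. apply sR. exists j. auto.
        * intros Hj. split; f_equal; apply sN; intros y (i & Hi & K).
          -- assert (i = j) by lia. congruence.
          -- assert (i = j) by (apply phiinj; lia). congruence. }
  (* [m'] lies beyond the partners of all points below [m], so a pair that crosses [m] does not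
     cross [m']. *)
  assert (step : forall m, exists m', m < m' /\ forall j,
     (2 * j + 1 < m -> 2 * phi j < m') /\ (2 * phi j < m -> 2 * j + 1 < m')).
  { intros m. destruct (bounded_on_segment (fun j => 2 * phi j) m) as [B HB].
    destruct (bounded_on_segment (fun j => 2 * psi j + 1) m) as [C HC].
    exists (S m + B + C). split; [lia |]. intros j. split; intros K.
    - assert (j < m) as L by lia. specialize (HB j L). simpl in HB. lia.
    - assert (phi j < m) as L by lia. specialize (HC _ L). cbv beta in HC. rewrite psiphi in HC. lia. }
  destruct (choice_fun _ step) as [nx Hnx].
  pose (e := fun n => Nat.iter n nx 0).
  assert (e_S : forall n, e (S n) = nx (e n)) by reflexivity.
  assert (e_lt : forall a b, a < b -> e (S a) <= e b).
  { intros a b L. induction L as [|b L IH]; [lia |].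
    rewrite (e_S b). destruct (Hnx (e b)) as [K _]. lia. }
  assert (e_ge : forall n, n <= e n).
  { induction n as [|n IH]; [lia |]. rewrite e_S. destruct (Hnx (e n)) as [K _]. lia. }
  assert (once' : forall a b j, a < b -> cross (e a) j -> cross (e b) j -> False).
  { intros a b j L K1 K2. pose proof (e_lt a b L) as M. rewrite e_S in M.
    destruct (Hnx (e a)) as [_ K]. specialize (K j). unfold cross in *. lia. }
  assert (once : forall a b j, cross (e a) j -> cross (e b) j -> a = b).
  { intros a b j K1 K2. destruct (lt_eq_lt_dec a b) as [[L | L] | L]; [| exact L |];
      exfalso; eauto. }
  (* The detour through odd indices replaces [phi] by involutions: the pairs [{2j+1, 2 phi(j)}] are
     disjoint for different [j]. *)
  destruct (real (fun n => if Nat.even n then S n else pred n)) as (h1 & Hh1 & h1E).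
  { intros n. destruct (Nat.even n) eqn:E.
    - rewrite Nat.even_succ, <- Nat.negb_even, E. reflexivity.
    - destruct n as [|n]; [discriminate |]. simpl pred.
      rewrite Nat.even_succ, <- Nat.negb_even in E.
      destruct (Nat.even n); [reflexivity | discriminate]. }
  { intros m. exists (2 * m). split; [lia |]. intros n L.
    destruct (Nat.even n) eqn:E; [| lia].
    apply Nat.even_spec in E. destruct E as [k ->]. lia. }
  (* The even cuts are crossed by none of the pairs handled here, the odd cuts by none of those left
     to [h3], since a pair crosses at most one cut. *)
  destruct (swap (fun j => ~ exists i, cross (e (2 * i)) j)) as (h2 & Hh2 & h2E).
  { intros m. exists (e (2 * m)). split; [specialize (e_ge (2 * m)); lia |].
    intros j N K. eauto. }
  destruct (swap (fun j => exists i, cross (e (2 * i)) j)) as (h3 & Hh3 & h3E).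
  { intros m. exists (e (2 * m + 1)). split; [specialize (e_ge (2 * m + 1)); lia |].
    intros j [i Hi] K. specialize (once _ _ _ Hi K). lia. }
  exists (fun x => h3 (h2 (h1 x))). split.
  { apply (comp (fun x => h2 (h1 x)) h3); [| exact Hh3]. now apply (comp h1 h2). }
  intros j. rewrite h1E.
  replace (Nat.even (2 * j)) with true by (symmetry; apply Nat.even_spec; now exists j).
  replace (S (2 * j)) with (2 * j + 1) by lia.
  destruct (h2E j) as [A1 A2], (h3E j) as [B1 B2].
  destruct (classic (exists i, cross (e (2 * i)) j)) as [C | C].
  - destruct (A2 (fun N => N C)) as [-> _]. now apply B1.
  - rewrite (A1 C). now apply B2.
Qed.

(** * The tree of a closed group *)

(** The points are handled in turn: an element fixing [Gam] and the earlier points, applied before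
    the current [h], keeps their images and takes [x k] off the finite preimage of [F] under [h]. *)
Lemma move_off_finite {T : Type} (G : (T -> T) -> Prop) (Gam : T -> Prop) (x : nat -> T) k
  (F : T -> Prop) :
  is_subgroup G ->
  (forall j, j < k ->
     ~ finite_set (orbit (ptstab G (fun y => Gam y \/ exists i, i < j /\ y = x i)) (x j))) ->
  finite_set F ->
  exists h, ptstab G Gam h /\ forall j, j < k -> ~ F (h (x j)).
Proof.
  intros HG Hx HF. induction k as [|k IH].
  - exists (fun y => y). split; [split; [apply HG | auto] | intros; lia].
  - destruct IH as (h & [Gh fixh] & Hh); [intros j L; apply Hx; lia |].
    assert (injh : injective h) by (apply Sym_injective; now apply HG).
    destruct (finite_preimage h F injh HF) as [l Hl].
    destruct (infinite_fresh _ (Hx k (Nat.lt_succ_diag_r k)) l) as (y & (m & [Gm fixm] & E) & Ny).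
    exists (fun z => h (m z)). split; [split |].
    + now apply HG.
    + intros z Hz. rewrite fixm by now left. auto.
    + intros j L K. destruct (Nat.eq_dec j k) as [-> | N].
      * apply Ny, Hl. now rewrite <- E.
      * apply (Hh j); [lia |]. rewrite fixm in K; [exact K |].
        right. exists j. split; [lia | reflexivity].
Qed.

(* A block is the list of values of an involution of [{0, ..., length b - 1}]. A
   label lists blocks, the latest first; the head of [b :: L] occupies the
   positions [size L, ..., size L + length b - 1]. *)
Definition valid_block (b : list nat) : Prop :=
  b <> [] /\ forall j, j < length b -> nth j b 0 < length b /\ nth (nth j b 0) b 0 = j.

Definition size (L : list (list nat)) : nat := length (concat L).

Definition level (n : nat) (L : list (list nat)) : Prop := Forall valid_block L /\ size L <= n.

Lemma size_cons b L : size (b :: L) = length b + size L.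
Proof. apply length_app. Qed.

Lemma level_cons n b L :
  level n (b :: L) -> 0 < length b /\ size L + length b <= n /\ level n L.
Proof.
  intros [HF Hs]. rewrite size_cons in Hs. inversion HF as [|? ? [N _] HL]; subst.
  destruct b as [|x b]; [now destruct N |].
  simpl length in *. repeat split; auto; lia.
Qed.

Lemma level_mono m n L : m <= n -> level m L -> level n L.
Proof. intros H [HF Hs]. split; [exact HF | lia]. Qed.

(** Valid blocks are nonempty, so a label of size at most [n] has at most [n] blocks, with at most
    [n] entries each, all below [n]. *)
Lemma level_finite n : finite_set (level n).
Proof.
  refine (finite_sub _ _ (finite_lists _ n (finite_lists _ n (finite_lt n))) _).
  intros L. induction L as [|b L IH]; intros HL.
  - split; [simpl; lia | constructor].
  - destruct (level_cons n b L HL) as (Hb & Hs & HL').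
    assert (valid_block b) as [_ V] by (destruct HL as [HF _]; now inversion HF).
    split.
    + assert (K : length L <= size L).
      { destruct HL' as [HF _]. clear -HF. induction HF as [|c L [Hc _] HF IH]; [simpl; lia |].
        rewrite size_cons. destruct c; [now destruct Hc | simpl; lia]. }
      simpl. lia.
    + constructor; [| now apply IH]. split; [lia |]. apply Forall_forall. intros v Hv.
      destruct (In_nth b v 0 Hv) as (j & Lj & <-). destruct (V j Lj). lia.
Qed.

(** The points that a new factor must fix at stage [j]. The last clause freezes preimages of the
    first [j] points, which makes the inverses converge along a branch. *)
Definition anchored {T : Type} (idx : T -> nat) (alp : nat -> T)
  (g : list (list nat) -> T -> T) (j : nat) (x : T) : Prop :=
  idx x < j \/ (exists i, i < j /\ x = alp i) \/ (exists L, level j L /\ idx (g L x) < j).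

(* [g] labels nodes by elements of [G] so that along a branch both they and their
   inverses converge pointwise ([tree_step]), while the points to which the nodes
   move the [alp j] of their last block are all distinct ([tree_inj]). *)
Record tree {T : Type} (G : (T -> T) -> Prop) (idx : T -> nat) (n : nat)
  (D : list (list nat) -> Prop) (alp : nat -> T) (g : list (list nat) -> T -> T) : Prop := {
  tree_root : forall x, g [] x = x;
  tree_mem : forall L, D L -> G (g L);
  tree_step : forall b L, D (b :: L) -> forall x,
    idx x < size L \/ (exists i, i < size L /\ x = alp i) \/ idx (g L x) < size L ->
    g (b :: L) x = g L x;
  tree_inj : forall b L b' L' j j', D (b :: L) -> D (b' :: L') ->
    j < length b -> j' < length b' ->
    g (b :: L) (alp (size L + j)) = g (b' :: L') (alp (size L' + j')) ->
    b :: L = b' :: L' /\ j = j';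
  tree_orbit : forall j, j < n ->
    ~ finite_set (orbit (ptstab G (anchored idx alp g j)) (alp j)) }.

Lemma orbit_infinite_sub {T : Type} (G : (T -> T) -> Prop) (P Q : T -> Prop) x :
  (forall y, P y -> Q y) -> ~ finite_set (orbit (ptstab G Q) x) ->
  ~ finite_set (orbit (ptstab G P) x).
Proof.
  intros PQ N K. apply N. refine (finite_sub _ _ K _).
  intros y (h & [Gh fh] & E). exists h. split; [split |]; auto.
Qed.

(** The conditions up to [n] see only [alp] below [n] and labels of size at most [n], so a stage
    that changes only other values keeps them. *)
Lemma tree_agree {T : Type} (G : (T -> T) -> Prop) idx n alp alp' g g' :
  (forall j, j < n -> alp' j = alp j) -> (forall L, level n L -> g' L = g L) ->
  @tree T G idx n (level n) alp g -> tree G idx n (level n) alp' g'.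
Proof.
  intros EA Eg [R M S I O]. split.
  - intros x. rewrite Eg; [apply R |]. split; [constructor | apply Nat.le_0_l].
  - intros L HL. rewrite Eg; auto.
  - intros b L HL x Hx. destruct (level_cons n b L HL) as (Hb & Hs & HL').
    rewrite !Eg in * by assumption. apply S; [exact HL |].
    destruct Hx as [Hx | [(i & Li & ->) | Hx]]; auto.
    right; left. exists i. split; [exact Li | apply EA; lia].
  - intros b L b' L' j j' HL HL' Lj Lj'.
    destruct (level_cons n b L HL) as (_ & Hs & _).
    destruct (level_cons n b' L' HL') as (_ & Hs' & _).
    rewrite !Eg, !EA by (assumption || lia). now apply I.
  - intros j Lj. rewrite EA by exact Lj. refine (orbit_infinite_sub G _ _ _ _ (O j Lj)).
    intros y [Hy | [(i & Li & ->) | (L & HL & Hy)]].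
    + now left.
    + right; left. exists i. split; [exact Li | apply EA; lia].
    + right; right. exists L. split; [exact HL |].
      rewrite Eg in Hy; [exact Hy |]. apply level_mono with j; [lia | exact HL].
Qed.

Lemma tree_sub {T : Type} (G : (T -> T) -> Prop) idx n (D D' : list (list nat) -> Prop) alp g :
  (forall L, D' L -> D L) -> @tree T G idx n D alp g -> tree G idx n D' alp g.
Proof.
  intros sub [R M S I O]. split; auto.
Qed.

(** For [i < j] the point [alp i] is anchored at [j]; were it equal to [alp j], the orbit of [alp j]
    would be a single point. *)
Lemma tree_alp_inj {T : Type} (G : (T -> T) -> Prop) idx n D alp g i j :
  @tree T G idx n D alp g -> i < n -> j < n -> alp i = alp j -> i = j.
Proof.
  intros [_ _ _ _ O].
  assert (K : forall i j, i < j -> j < n -> alp i <> alp j).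
  { clear i j. intros i j Li Lj E. apply (O j Lj). exists [alp j].
    intros y (h & [_ fh] & <-). left. symmetry. apply fh.
    right; left. exists i. auto. }
  intros Li Lj E. destruct (lt_eq_lt_dec i j) as [[L | L] | L]; [| exact L |]; exfalso.
  - now apply (K i j).
  - now apply (K j i).
Qed.

(** The element at [b :: L] is the one at [L] preceded by some [h] in [G] that fixes the points
    anchored at [size L] and makes the new block avoid all places already taken. *)
Lemma tree_add_node {T : Type} (G : (T -> T) -> Prop) idx n (D : list (list nat) -> Prop)
  alp g b L :
  is_subgroup G -> @tree T G idx (S n) D alp g ->
  (forall L', level n L' -> D L') -> (forall L', D L' -> level (S n) L') ->
  level (S n) (b :: L) -> size (b :: L) = S n -> ~ D (b :: L) ->
  exists g', (forall L', L' <> b :: L -> g' L' = g L') /\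
    tree G idx (S n) (fun L' => D L' \/ L' = b :: L) alp g'.
Proof.
  intros HG HT lower upper HbL Hsize new.
  assert (HTc := HT). destruct HTc as [R M S I O].
  destruct (level_cons _ _ _ HbL) as (Hb & _ & HL).
  rewrite size_cons in Hsize.
  assert (HLn : level (size L) L) by (split; [apply HL | lia]).
  assert (DL : D L) by (apply lower, level_mono with (size L); [lia | exact HLn]).
  assert (injL : injective (g L)) by (apply Sym_injective, HG; auto).
  (* The images of all [alp j] under all present nodes: a finite set containing every place that the
     new block has to avoid. *)
  pose (used := fun y => exists bL, D bL /\
     exists j, j < Datatypes.S n /\ y = g bL (alp j)).
  assert (finused : finite_set used).
  { apply finite_bind.
    - refine (finite_sub _ _ (level_finite (Datatypes.S n)) upper).
    - intros bL _. apply finite_image with (f := fun j => g bL (alp j)), finite_lt. }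
  destruct (move_off_finite G (anchored idx alp g (size L)) (fun j => alp (size L + j))
     (length b) (fun y => used (g L y)) HG) as (h & [Gh fixh] & Hh).
  { intros j Lj. assert (Lj' : size L + j < Datatypes.S n) by lia.
    refine (orbit_infinite_sub G _ _ _ _ (O _ Lj')).
    intros y [[Hy | [(i & Li & ->) | (L' & HL' & Hy)]] | (i & Li & ->)].
    - left. lia.
    - right; left. exists i. split; [lia | reflexivity].
    - right; right. exists L'. split; [apply level_mono with (size L); [lia | exact HL'] | lia].
    - right; left. exists (size L + i). split; [lia | reflexivity]. }
  { now apply finite_preimage. }
  assert (injh : injective h) by (apply Sym_injective, HG; auto).
  pose (g' := fun L' => if list_eq_dec (list_eq_dec Nat.eq_dec) L' (b :: L)
     then fun x => g L (h x) else g L').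
  assert (g'new : g' (b :: L) = fun x => g L (h x)).
  { unfold g'. destruct (list_eq_dec _ _ _); [reflexivity | contradiction]. }
  assert (g'old : forall L', L' <> b :: L -> g' L' = g L').
  { intros L' N. unfold g'. destruct (list_eq_dec _ _ _); [contradiction | reflexivity]. }
  assert (g'D : forall L', D L' -> g' L' = g L').
  { intros L' HL'. apply g'old. intros ->. contradiction. }
  assert (noself : L <> b :: L).
  { intros E. apply (f_equal (@length _)) in E. simpl in E. lia. }
  assert (avoid : forall b' L' j j', D (b' :: L') -> j < length b -> j' < length b' ->
     g' (b :: L) (alp (size L + j)) <> g' (b' :: L') (alp (size L' + j'))).
  { intros b' L' j j' HD Lj Lj' E. rewrite g'new, (g'D _ HD) in E.
    apply (Hh j Lj). rewrite E. exists (b' :: L'). split; [exact HD |].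
    exists (size L' + j'). split; [| reflexivity].
    destruct (level_cons _ _ _ (upper _ HD)) as (_ & K & _). lia. }
  exists g'. split; [exact g'old |]. split.
  - intros x. rewrite g'old by discriminate. apply R.
  - intros L' [HD | ->].
    + rewrite g'D; auto.
    + rewrite g'new. apply HG; auto.
  - intros b' L' [HD | E] x Hx.
    + assert (L' <> b :: L).
      { intros ->. destruct (level_cons _ _ _ (upper _ HD)) as (K1 & K2 & _).
        rewrite size_cons in K2. lia. }
      rewrite (g'old L') in * by assumption. rewrite (g'D _ HD). now apply S.
    + injection E as -> ->. rewrite (g'old L noself) in *. rewrite g'new.
      rewrite fixh; [reflexivity |].
      destruct Hx as [Hx | [Hx | Hx]]; [now left | right; now left | right; right; eauto].
  - intros b1 L1 b2 L2 j1 j2 [H1 | E1] [H2 | E2] Lj1 Lj2 E.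
    + rewrite !g'D in E by assumption. now apply I.
    + injection E2 as -> ->. symmetry in E. now apply avoid in E.
    + injection E1 as -> ->. now apply avoid in E.
    + injection E1 as -> ->. injection E2 as -> ->. split; [reflexivity |].
      rewrite g'new in E. apply injL, injh in E.
      apply (tree_alp_inj G idx _ D alp g _ _ HT) in E; lia.
  (* The new label has size [S n], so it is not of level [j] for any [j] below [S n] and does not
     enlarge the anchored sets. *)
  - intros j Lj. refine (orbit_infinite_sub G _ _ _ _ (O j Lj)).
    intros y [Hy | [Hy | (L' & HL' & Hy)]]; [now left | right; now left |].
    right; right. exists L'. split; [exact HL' |]. rewrite g'old in Hy; [exact Hy |].
    intros ->. destruct HL' as [_ K]. rewrite size_cons in K. lia.
Qed.

Lemma tree_add_level {T : Type} (G : (T -> T) -> Prop) idx n alp g :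
  is_subgroup G -> @tree T G idx (S n) (level n) alp g ->
  exists g', (forall L, level n L -> g' L = g L) /\ tree G idx (S n) (level (S n)) alp g'.
Proof.
  intros HG HT.
  assert (K : forall ls, exists g', (forall L, level n L -> g' L = g L) /\
    tree G idx (S n) (fun L => level n L \/ (In L ls /\ level (S n) L /\ size L = S n)) alp g').
  { induction ls as [|l ls (g' & agr & HT')].
    - exists g. split; [auto |]. refine (tree_sub G idx _ _ _ _ _ _ HT).
      intros L [H | [[] _]]. exact H.
    - destruct (classic (level (S n) l /\ size l = S n /\ ~ In l ls)) as [(Hl & Sl & Nl) | N].
      + destruct l as [|b L]; [discriminate |].
        destruct (tree_add_node G idx n _ alp g' b L HG HT') as (g'' & agr' & HT'').
        * auto.
        * intros L' [H | (_ & H & _)]; [apply level_mono with n; [lia | exact H] | exact H].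
        * exact Hl.
        * exact Sl.
        * intros [[_ H] | [H _]]; [lia | contradiction].
        * exists g''. split.
          -- intros L' HL'. rewrite agr'; [auto |]. intros ->. destruct HL' as [_ H]. lia.
          -- refine (tree_sub G idx _ _ _ _ _ _ HT'').
             intros L' [H | ([<- | H] & H')]; auto.
      + exists g'. split; [exact agr |]. refine (tree_sub G idx _ _ _ _ _ _ HT').
        intros L' [H | ([<- | H] & H')]; auto.
        right. split; [| exact H']. apply NNPP. intros Nl. apply N. tauto. }
  destruct (level_finite (S n)) as [ls Hls].
  destruct (K ls) as (g' & agr & HT'). exists g'. split; [exact agr |].
  refine (tree_sub G idx _ _ _ _ _ _ HT'). intros L HL.
  destruct (le_lt_dec (size L) n) as [Le | Lt].
  - left. split; [apply HL | exact Le].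
  - right. split; [auto |]. split; [exact HL |]. destruct HL as [_ H]. lia.
Qed.

Definition locally_movable {T : Type} (G : (T -> T) -> Prop) : Prop :=
  forall Gamma : T -> Prop, finite_set Gamma ->
  exists alpha : T, ~ finite_set (orbit (ptstab G Gamma) alpha).

(** Only finitely many labels have level [n], so the points anchored at [n] form a finite set and
    local movability supplies the next point [a]. *)
Lemma tree_grow {T : Type} (G : (T -> T) -> Prop) idx n alp g :
  injective idx -> is_subgroup G -> locally_movable G ->
  @tree T G idx n (level n) alp g ->
  exists alp' g', (forall j, j < n -> alp' j = alp j) /\ (forall L, level n L -> g' L = g L) /\
    tree G idx (S n) (level (S n)) alp' g'.
Proof.
  intros inj HG mov HT.
  assert (fidx : finite_set (fun x => idx x < n)).
  { apply finite_preimage with (P := fun m => m < n); [exact inj | apply finite_lt]. }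
  destruct (mov (anchored idx alp g n)) as [a Ha].
  { apply finite_or; [exact fidx |]. apply finite_or.
    - apply finite_image with (f := alp), finite_lt.
    - apply finite_bind; [apply level_finite |]. intros L HL.
      apply finite_preimage with (f := g L) (P := fun x => idx x < n); [| exact fidx].
      apply Sym_injective, HG, (tree_mem _ _ _ _ _ _ HT), HL. }
  pose (alp' := fun j => if j =? n then a else alp j).
  assert (old : forall j, j < n -> alp' j = alp j).
  { intros j L. unfold alp'. destruct (Nat.eqb_spec j n); [lia | reflexivity]. }
  assert (new : alp' n = a) by (unfold alp'; now rewrite Nat.eqb_refl).
  destruct (tree_add_level G idx n alp' g HG) as (g' & agr & HT').
  - destruct (tree_agree G idx n alp alp' g g old (fun _ _ => eq_refl) HT) as [R M S I O].
    split; auto. intros j Lj. destruct (Nat.eq_dec j n) as [-> | N]; [| apply O; lia].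
    rewrite new. refine (orbit_infinite_sub G _ _ _ _ Ha).
    intros y [Hy | [(i & Li & ->) | Hy]]; [now left | right; left | right; now right].
    exists i. auto.
  - exists alp', g'. auto.
Qed.

Lemma tree_exists {T : Type} (G : (T -> T) -> Prop) (idx : T -> nat) :
  injective idx -> is_subgroup G -> locally_movable G ->
  exists alp g, forall n, tree G idx n (level n) alp g.
Proof.
  intros inj HG mov.
  assert (pt : exists x : T, True).
  { destruct (mov (fun _ => False)) as [x _]; [exists []; auto | eauto]. }
  destruct pt as [x0 _].
  destruct (choice_fun (fun (p : nat * ((nat -> T) * (list (list nat) -> T -> T))) s' =>
    let '(n, (alp, g)) := p in tree G idx n (level n) alp g ->
    (forall j, j < n -> fst s' j = alp j) /\ (forall L, level n L -> snd s' L = g L) /\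
    tree G idx (S n) (level (S n)) (fst s') (snd s'))) as [nx Hnx].
  { intros (n & alp & g). destruct (classic (tree G idx n (level n) alp g)) as [HT | N].
    - destruct (tree_grow G idx n alp g inj HG mov HT) as (alp' & g' & K).
      exists (alp', g'). auto.
    - exists (alp, g). contradiction. }
  pose (st := fix st n := match n with
     | 0 => (fun _ => x0, fun _ x => x) | S n => nx (n, st n) end).
  assert (Hst : forall n, tree G idx n (level n) (fst (st n)) (snd (st n))).
  { induction n as [|n IH].
    - simpl. split; auto.
      + intros L _. apply HG.
      + intros b L b' L' j j' H. destruct (level_cons _ _ _ H). lia.
      + intros; lia.
    - specialize (Hnx (n, st n)). destruct (st n) as [alp g] eqn:E.
      change (st (S n)) with (nx (n, st n)). rewrite E. apply Hnx. exact IH. }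
  assert (agr : forall n m, n <= m -> (forall j, j < n -> fst (st m) j = fst (st n) j) /\
     (forall L, level n L -> snd (st m) L = snd (st n) L)).
  { intros n m Le. induction Le as [|m Le [IH1 IH2]]; [auto |].
    specialize (Hnx (m, st m)). change (st (S m)) with (nx (m, st m)).
    pose proof (Hst m) as Hm. destruct (st m) as [alp g] eqn:E. simpl in Hm.
    destruct (Hnx Hm) as (K1 & K2 & _). split.
    - intros j Lj. rewrite K1 by lia. now apply IH1.
    - intros L HL. rewrite K2; [now apply IH2 |]. now apply level_mono with n. }
  (* [alp j] is settled from stage [S j] on and [g L] from stage [size L] on; the limit reads them
     there. *)
  exists (fun j => fst (st (S j)) j), (fun L => snd (st (size L)) L). intros n.
  refine (tree_agree G idx n _ _ _ _ _ _ (Hst n)).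
  - intros j Lj. symmetry. apply (agr (S j) n); lia.
  - intros L [HF Hs]. symmetry. apply (agr (size L) n Hs). split; [exact HF | lia].
Qed.

(** * Branches of the tree and the involution acting along them *)

Lemma locally_bounded_cuts (s : nat -> nat) :
  locally_bounded s ->
  exists e : nat -> nat, e 0 = 0 /\ (forall i, e i < e (S i)) /\
    forall i n, n < e i -> s n < e i.
Proof.
  (* Asking for a bound of at least [S m] rather than [m] makes the cuts strictly increasing. *)
  intros H. destruct (choice_fun _ (fun m => H (S m))) as [nx Hnx].
  exists (fun i => Nat.iter i nx 0). split; [reflexivity |]. split.
  - intros i. change (Nat.iter (S i) nx 0) with (nx (Nat.iter i nx 0)).
    destruct (Hnx (Nat.iter i nx 0)). lia.
  - intros [|i] n L; [simpl in L; lia |].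
    change (Nat.iter (S i) nx 0) with (nx (Nat.iter i nx 0)) in *. now apply Hnx.
Qed.

Lemma nth_map_seq (f : nat -> nat) n j : j < n -> nth j (map f (seq 0 n)) 0 = f j.
Proof.
  intros L. rewrite nth_indep with (d' := f 0) by now rewrite length_map, length_seq.
  rewrite map_nth, seq_nth; auto.
Qed.

Lemma locally_bounded_branch (s : nat -> nat) :
  (forall n, s (s n) = n) -> locally_bounded s ->
  exists (e : nat -> nat) (L : nat -> list (list nat)) (b : nat -> list nat),
    e 0 = 0 /\ L 0 = [] /\
    forall i, e i < e (S i) /\ L (S i) = b i :: L i /\ Forall valid_block (L i) /\
      size (L i) = e i /\ length (b i) = e (S i) - e i /\
      forall j, j < length (b i) -> s (e i + j) = e i + nth j (b i) 0.
Proof.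
  intros ss lb. destruct (locally_bounded_cuts s lb) as (e & e0 & elt & es).
  pose (b := fun i => map (fun j => s (e i + j) - e i) (seq 0 (e (S i) - e i))).
  pose (L := fix L i := match i with 0 => [] | S i => b i :: L i end).
  assert (lenb : forall i, length (b i) = e (S i) - e i).
  { intros i. unfold b. now rewrite length_map, length_seq. }
  assert (sb : forall i j, j < length (b i) ->
     s (e i + j) = e i + nth j (b i) 0 /\ nth j (b i) 0 < length (b i)).
  { intros i j Lj. rewrite lenb in *. unfold b. rewrite nth_map_seq by exact Lj.
    assert (s (e i + j) < e (S i)) by (apply es; lia).
    (* An involution that preserves the segment below [e i] also preserves its complement. *)
    assert (e i <= s (e i + j)).
    { destruct (le_lt_dec (e i) (s (e i + j))) as [K | K]; [exact K |].
      apply es in K. rewrite ss in K. lia. }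
    lia. }
  assert (vb : forall i, valid_block (b i)).
  { intros i. split.
    - intros E. specialize (lenb i). rewrite E in lenb. specialize (elt i). simpl in lenb. lia.
    - intros j Lj. destruct (sb i j Lj) as [E1 L1]. split; [exact L1 |].
      destruct (sb i _ L1) as [E2 _]. rewrite <- E1, ss in E2. lia. }
  exists e, L, b. split; [exact e0 | split; [reflexivity |]]. intros i.
  split; [apply elt |]. split; [reflexivity |]. split; [| split; [| split; [apply lenb |]]].
  - induction i as [|i IH]; simpl; constructor; auto.
  - induction i as [|i IH]; [now rewrite e0 |].
    change (L (S i)) with (b i :: L i). rewrite size_cons, lenb, IH.
    specialize (elt i). lia.
  - intros j Lj. now apply sb.
Qed.

Lemma tree_branch_limit {T : Type} (G : (T -> T) -> Prop) (idx : T -> nat) alp g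
  (L : nat -> list (list nat)) (b : nat -> list nat) (e : nat -> nat) :
  is_subgroup G -> closed_sub G -> injective idx ->
  (forall n, tree G idx n (level n) alp g) ->
  e 0 = 0 ->
  (forall i, e i < e (S i) /\ L (S i) = b i :: L i /\ Forall valid_block (L i) /\
     size (L i) = e i) ->
  exists k, G k /\ forall i j, j < e i -> k (alp j) = g (L i) (alp j).
Proof.
  intros HG cl inj HT e0 HL.
  assert (ege : forall i, i <= e i).
  { induction i as [|i IH]; [lia |]. destruct (HL i). lia. }
  assert (GL : forall i, G (g (L i))).
  { intros i. apply (tree_mem _ _ _ _ _ _ (HT (e i))). destruct (HL i) as (_ & _ & F & S).
    split; [exact F | lia]. }
  assert (stable : forall i m x, i <= m ->
     idx x < e i \/ (exists j, j < e i /\ x = alp j) \/ idx (g (L i) x) < e i ->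
     g (L m) x = g (L i) x).
  { intros i m x Le Hx. induction Le as [|m Le IH]; [reflexivity |].
    destruct (HL m) as (_ & EL & _ & Sz). rewrite <- IH, EL.
    assert (Lem : e i <= e m).
    { clear -Le HL. induction Le as [|m Le IH]; [lia |]. destruct (HL m). lia. }
    apply (tree_step _ _ _ _ _ _ (HT (e (S m)))).
    - rewrite <- EL. destruct (HL (S m)) as (_ & _ & F & S). split; [exact F | lia].
    - rewrite Sz, IH. destruct Hx as [Hx | [(j & Lj & ->) | Hx]]; [left; lia | | right; right; lia].
      right; left. exists j. split; [lia | reflexivity]. }
  pose (k := fun x => g (L (S (idx x))) x).
  assert (kE : forall m x, idx x < m -> k x = g (L m) x).
  { intros m x Lt. unfold k. symmetry. apply stable; [lia |].
    left. specialize (ege (S (idx x))). lia. }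
  assert (Gk : G k).
  { apply cl.
    - apply bijection_Sym.
      + intros x y E. rewrite (kE (S (idx x) + S (idx y)) x), (kE (S (idx x) + S (idx y)) y) in E
          by lia.
        revert E. apply Sym_injective. now apply HG.
      + intros y. assert (Sg : Sym (g (L (S (idx y))))) by now apply HG.
        destruct Sg as (v & _ & gv). exists (v y).
        rewrite (kE (S (idx y) + S (idx (v y)))) by lia.
        transitivity (g (L (S (idx y))) (v y)); [| apply gv]. apply stable; [lia |].
        right; right. rewrite gv. specialize (ege (S (idx y))). lia.
    - intros Gamma.
      assert (bd : exists m, forall x, In x Gamma -> idx x < m).
      { induction Gamma as [|a Gamma [m Hm]]; [exists 0; intros x [] |].
        exists (m + S (idx a)). intros x [<- | Hx]; [lia |]. specialize (Hm x Hx). lia. }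
      destruct bd as [m Hm]. exists (g (L m)). split; [auto |].
      intros x Hx. symmetry. apply kE. auto. }
  exists k. split; [exact Gk |]. intros i j Lj.
  rewrite (kE (i + S (idx (alp j)))) by lia. apply stable; [lia | eauto].
Qed.

Lemma find_block (e : nat -> nat) :
  e 0 = 0 -> (forall i, e i < e (S i)) -> forall n, exists i, e i <= n < e (S i).
Proof.
  intros e0 elt n. induction n as [|n [i [H1 H2]]].
  - exists 0. specialize (elt 0). lia.
  - destruct (Nat.eq_dec (S n) (e (S i))) as [E | N].
    + exists (S i). specialize (elt (S i)). lia.
    + exists i. lia.
Qed.

(* [u] acts at the images of the blocks under the nodes of the tree; as these images
   are distinct and each block carries its own involution, one [u] serves all branches. *)
Lemma locally_bounded_realizer {T : Type} (G : (T -> T) -> Prop) (idx : T -> nat) :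
  injective idx -> is_subgroup G -> closed_sub G -> locally_movable G ->
  exists alp u, injective alp /\ Sym u /\
    forall H, is_subgroup H -> (forall f, G f -> H f) -> H u ->
    forall s, (forall n, s (s n) = n) -> locally_bounded s ->
    exists h, H h /\ forall j, h (alp j) = alp (s j).
Proof.
  intros inj HG cl mov.
  destruct (tree_exists G idx inj HG mov) as (alp & g & HT).
  assert (Hval : forall n b L, level n (b :: L) -> valid_block b).
  { intros n b L [HF _]. now inversion HF. }
  destruct (involution_of_matching (fun x y => exists n b L j, level n (b :: L) /\
    j < length b /\ x = g (b :: L) (alp (size L + j)) /\
    y = g (b :: L) (alp (size L + nth j b 0)))) as (u & uu & uR & _).
  - intros x y (n & b & L & j & HL & Lj & -> & ->).
    destruct (Hval n b L HL) as [_ V]. destruct (V j Lj) as [Lt E].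
    exists n, b, L, (nth j b 0). rewrite E. auto.
  - intros x y z (n & b & L & j & HL & Lj & -> & ->) (n' & b' & L' & j' & HL' & Lj' & E & ->).
    apply (tree_inj _ _ _ _ _ _ (HT (n + n'))) in E; auto.
    + destruct E as [E ->]. now injection E as -> ->.
    + apply level_mono with n; [lia | exact HL].
    + apply level_mono with n'; [lia | exact HL'].
  - exists alp, u. split; [| split; [now apply involution_Sym |]].
    { intros i j E. apply (tree_alp_inj G idx _ _ alp g i j (HT (S (i + j)))); auto; lia. }
    intros H HH GH Hu s ss lb.
    destruct (locally_bounded_branch s ss lb) as (e & L & b & e0 & L0 & HL).
    destruct (tree_branch_limit G idx alp g L b e HG cl inj HT e0) as (k & Gk & kE).
    { intros i. destruct (HL i) as (A & B & C & D & _). auto. }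
    assert (Hk : H k) by auto.
    assert (HHc := HH). destruct HHc as (_ & _ & _ & comp & inv).
    destruct (inv k Hk) as (k' & Hk' & k'k & kk').
    exists (fun x => k' (u (k x))). split.
    { apply (comp (fun x => u (k x)) k'); [| exact Hk']. now apply (comp k u). }
    intros n. destruct (find_block e e0 (fun i => proj1 (HL i)) n) as (i & L1 & L2).
    destruct (HL i) as (_ & EL & _ & Sz & lenb & sb).
    destruct (HL (S i)) as (_ & _ & F & Sz' & _).
    assert (Lj : n - e i < length (b i)) by lia.
    assert (HLS : level (e (S i)) (b i :: L i)) by (rewrite <- EL; split; [exact F | lia]).
    destruct (Hval _ _ _ HLS) as [_ V]. destruct (V _ Lj) as [Lt _].
    specialize (sb _ Lj). replace (e i + (n - e i)) with n in sb by lia.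
    (* [n] and [s n] lie in the same block, on which [k] agrees with the node [b i :: L i]; there
       [u] was built to act as the block does. *)
    rewrite <- (k'k (alp (s n))). f_equal.
    rewrite (kE (S i) n L2), (kE (S i) (s n)) by lia. rewrite EL.
    apply uR. exists (e (S i)), (b i), (L i), (n - e i).
    rewrite Sz, <- sb. replace (e i + (n - e i)) with n by lia. auto.
Qed.

(** * The orbit criterion in both directions *)

Theorem theorem5p3 (T : Type) (HT : countably_infinite T)
  (G : (T -> T) -> Prop) (HG : is_subgroup G) (Hcl : closed_sub G) :
  approx G (@Sym T) <->
  (forall Gamma : T -> Prop, finite_set Gamma ->
     exists alpha : T, ~ finite_set (orbit (ptstab G Gamma) alpha)).
Proof.
  split.
  - intros [_ pre] Gamma [l Hl]. apply NNPP. intros N.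
    apply (finite_orbits_not_full G l HT HG); [| exact pre].
    intros x. apply NNPP. intros inf. apply N. exists x.
    now apply (orbit_infinite_sub G Gamma (fun y => In y l) x Hl).
  - intros mov. destruct HT as (e & _ & esurj).
    destruct (choice_fun _ esurj) as [idx Hidx].
    assert (inj : injective idx).
    { intros x y E. now rewrite <- (Hidx x), <- (Hidx y), E. }
    destruct (locally_bounded_realizer G idx inj HG Hcl mov) as (alp & u & injalp & Su & real).
    (* The odd indices are auxiliary room for permuting the even ones, and they keep the complement
       of the moiety infinite. *)
    pose (gam := fun j => alp (2 * j)).
    assert (injgam : injective gam).
    { intros i j E. apply injalp in E. lia. }
    destruct (full_set_supports gam injgam) as (z & Sz & supp).
    (* [chi] marks row 0 of [gam], the support on which all permutations are obtained. *)
    destruct (choice_fun (fun x c => c = true <-> exists i, x = gam (to_nat (0, i))))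
      as [chi Hchi].
    { intros x. destruct (classic (exists i, x = gam (to_nat (0, i)))) as [H | H];
        [exists true | exists false]; split; intros; congruence || auto. }
    destruct (moiety_generates idx chi inj) as (d & t & Sd & St & gen).
    { intros [].
      - apply infinite_of_sequence with (x := fun i => gam (to_nat (0, i))).
        + intros i j E. apply injgam, (f_equal of_nat) in E.
          rewrite !cancel_of_to in E. congruence.
        + intros i. apply Hchi. now exists i.
      - apply infinite_of_sequence with (x := fun i => alp (2 * i + 1)).
        + intros i j E. apply injalp in E. lia.
        + intros i. apply not_true_is_false. intros K. apply Hchi in K.
          destruct K as [j K]. apply injalp in K. lia. }
    split.
    + exists (fun _ => False). split; [exists []; auto |]. split; [intros f [] |].
      intros f Gf. apply generated_incl. left. now apply HG.
    + exists (fun h => In h [u; z; d; t]). split; [apply finite_In |].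
      assert (HU : forall h, In h [u; z; d; t] -> Sym h).
      { intros h [<- | [<- | [<- | [<- | []]]]]; assumption. }
      split; [exact HU |].
      set (H := generated (fun h => G h \/ In h [u; z; d; t])).
      assert (HH : is_subgroup H).
      { apply generated_subgroup. intros h [Gh | Uh]; [now apply HG | auto]. }
      assert (UH : forall h, In h [u; z; d; t] -> H h).
      { intros h Uh. apply generated_incl. now right. }
      apply (gen H HH); [apply UH; simpl; tauto | apply UH; simpl; tauto |].
      intros w Sw Hw. apply (supp H HH); [apply UH; simpl; tauto | | exact Sw |].
      * apply (locally_bounded_involutions_full alp H HH).
        apply (real H HH); [| apply UH; simpl; tauto].
        intros f Gf. apply generated_incl. now left.
      * intros x N. apply Hw. apply not_true_is_false. intros K.
        apply Hchi in K. destruct K as [i K]. now apply (N i).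
Qed.
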